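(* Let $k$ be a field, $\mathbf{V}$ a variety of $k$-algebras, and $d$ a natural number (with $d=0$ allowed). Consider the following condition: $( * )_d$ For every monomial $u$ obtained by bracketing the ordered string $x_1\dots x_{d+2}$ of $d+2$ indeterminates, each of the monomials $uz$, $zu$ in the $d+3$ indeterminates $x_1,\dots,x_{d+2},z$ is congruent modulo the homogeneous identities of $\mathbf{V}$ to a $k$-linear combination of monomials of the form $u'u''$, in which one of $u',u''$ is a product (in some order, with some bracketing) of a proper nonempty subset of $x_1,\dots,x_{d+2}$ (each element of the subset occurring once), and the other is a product (in some order, with some bracketing) of $z$ and those of the $x_m$ not occurring in the former product (each occurring once). Then: (a) If $\mathbf{V}$ satisfies $( * )_d$, then $\mathbf{V}$ is $[1,1+d]$-separative. (b) For $d=0$, condition $( * )_0$ is equivalent to the condition that $\mathbf{V}$ satisfies identities modulo which each of the monomials $(xy)z$ and $z(xy)$ is congruent to some $k$-linear combination of the eight monomials $x(yz)$, $x(zy)$, $(yz)x$, $(zy)x$, $y(xz)$, $y(zx)$, $(xz)y$, $(zx)y$. (c) If $k$ has characteristic not $2$, the variety of Jordan algebras over $k$ satisfies $( * )_1$.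
   Context: Algebras: a $k$-algebra is a $k$-vector space with a $k$-bilinear multiplication, not assumed associative, commutative or unital. A variety of $k$-algebras is the class of all $k$-algebras satisfying a fixed set of identities. The variety of Jordan algebras over $k$ (characteristic not $2$) is defined by the identities $xy=yx$ and $(xy)(xx)=x(y(xx))$. Monomials: a monomial is a nonempty bracketed product of indeterminates (repetitions allowed); its length (or degree) is its length as a string of letters, ignoring parentheses. Every monomial $w$ of length $>1$ is uniquely a product $w=w'w''$ of two monomials; the submonomials of $w$ are $w$ itself and, if $\mathrm{length}(w)>1$, the submonomials of $w'$ and of $w''$. An identity says that a $k$-linear combination of monomials evaluates to zero; it is homogeneous if all the monomials in it have the same number of occurrences of each variable. Separativity: for a natural number $m$, a monomial $w$ is $m$-separating if it has a submonomial of length exactly $\mathrm{length}(w)-m$. For natural numbers $n\le N$, $w$ is $[n,N]$-separating if it is $m$-separating for some $m\in\{n,n+1,\dots,N\}$. For a natural number $d$, a variety $\mathbf{V}$ of $k$-algebras is $[1,1+d]$-separative if every monomial of degree $>1$ is congruent modulo homogeneous identities of $\mathbf{V}$ to a $k$-linear combination of $[1,1+d]$-separating monomials. *)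

(* Defs.v *)
From HB Require Import structures.
From mathcomp Require Import all_boot all_order all_algebra finmap.
From mathcomp Require Import sesquilinear.
From mathcomp.multinomials Require Import monalg.

Set Implicit Arguments.
Unset Strict Implicit.
Unset Printing Implicit Defensive.

Import GRing.Theory.

Local Open Scope ring_scope.

(* Elements of the free magma on countably many indeterminates; [Var i] is    *)
(* the indeterminate of index [i].                                            *)
Inductive monom : Type := Var of nat | Mul of monom & monom.

Fixpoint monom_encode (w : monom) : GenTree.tree nat :=
  match w with
  | Var i => GenTree.Leaf i
  | Mul u v => GenTree.Node 0 [:: monom_encode u; monom_encode v]
  end.

Fixpoint monom_decode (t : GenTree.tree nat) : option monom :=
  match t with
  | GenTree.Leaf i => Some (Var i)
  | GenTree.Node _ [:: t1; t2] =>
      if (monom_decode t1, monom_decode t2) is (Some u, Some v)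
      then Some (Mul u v) else None
  | _ => None
  end.

Lemma monom_encodeK : pcancel monom_encode monom_decode.
Proof. by elim=> //= u -> v ->. Qed.

HB.instance Definition _ := Countable.copy monom (pcan_type monom_encodeK).

Declare Scope monom_scope.
Delimit Scope monom_scope with M.
Bind Scope monom_scope with monom.
Notation "u * v" := (Mul u v) : monom_scope.

(* The underlying string of a monomial, obtained by dropping parentheses.     *)
Fixpoint letters (w : monom) : seq nat :=
  match w with
  | Var i => [:: i]
  | Mul u v => letters u ++ letters v
  end.

Definition len (w : monom) : nat := size (letters w).

Fixpoint submonomials (w : monom) : seq monom :=
  w :: match w with
       | Var _ => [::]
       | Mul u v => submonomials u ++ submonomials v
       end.

(* Written additively to avoid truncated subtraction.                         *)
Definition separating (m : nat) (w : monom) : Prop :=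
  exists2 v, v \in submonomials w & (len v + m = len w)%N.

Definition range_separating (n N : nat) (w : monom) : Prop :=
  exists2 m : nat, (n <= m <= N)%N & separating m w.

Record algebra (k : fieldType) := Algebra {
  carrier :> lmodType k;
  amul : {bilinear carrier -> carrier -> carrier}
}.

Fixpoint eval_monom (k : fieldType) (A : algebra k) (a : nat -> A)
    (w : monom) : A :=
  match w with
  | Var i => a i
  | Mul u v => amul A (eval_monom a u) (eval_monom a v)
  end.

(* [{malg k[monom]}] is the space of k-linear combinations of monomials, i.e. *)
(* the underlying vector space of the free nonassociative algebra.            *)
Definition eval (k : fieldType) (A : algebra k) (a : nat -> A)
    (f : {malg k[monom]}) : A :=
  \sum_(w <- msupp f) f@_w *: eval_monom a w.

Definition satisfies (k : fieldType) (A : algebra k) (f : {malg k[monom]}) :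
    Prop :=
  forall a : nat -> A, eval a f = 0.

Definition variety_of (k : fieldType) (S : {malg k[monom]} -> Prop)
    (A : algebra k) : Prop :=
  forall f, S f -> satisfies A f.

Definition is_variety (k : fieldType) (V : algebra k -> Prop) : Prop :=
  exists S, forall A, V A <-> variety_of S A.

Definition identity_of (k : fieldType) (V : algebra k -> Prop)
    (f : {malg k[monom]}) : Prop :=
  forall A, V A -> satisfies A f.

Definition homogeneous (k : fieldType) (f : {malg k[monom]}) : Prop :=
  forall v w, v \in msupp f -> w \in msupp f ->
  forall i : nat, count_mem i (letters v) = count_mem i (letters w).

Definition congruent (k : fieldType) (V : algebra k -> Prop)
    (f g : {malg k[monom]}) : Prop :=
  identity_of V (f - g).

(* The homogeneous identities of V are stable under scaling and under left    *)
(* and right multiplication by monomials, so their finite sums already form   *)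
(* the ideal that they generate.                                              *)
Definition hcongruent (k : fieldType) (V : algebra k -> Prop)
    (f g : {malg k[monom]}) : Prop :=
  exists2 s : seq {malg k[monom]},
    forall h, h \in s -> identity_of V h /\ homogeneous h
    & f - g = \sum_(h <- s) h.

Definition lin_comb (k : fieldType) (P : monom -> Prop)
    (g : {malg k[monom]}) : Prop :=
  forall w, w \in msupp g -> P w.

Definition separative (k : fieldType) (V : algebra k -> Prop) (d : nat) :
    Prop :=
  forall w, (1 < len w)%N ->
  exists2 g : {malg k[monom]},
    lin_comb (range_separating 1 (1 + d)) g & hcongruent V << w >> g.

(* The indeterminates x_1, ..., x_(d+2) are [Var 0], ..., [Var d.+1] and z is *)
(* [Var d.+2]; [B] is the set of the x_m occurring in [p].                    *)
Definition splits (d : nat) (p q : monom) : Prop :=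
  exists B : {set 'I_d.+2},
    [/\ B != set0, B \proper [set: 'I_d.+2],
        perm_eq (letters p) [seq val i | i <- enum B]
      & perm_eq (letters q) (d.+2 :: [seq val i | i <- enum (~: B)])].

Definition star_form (d : nat) (w : monom) : Prop :=
  exists u' u'' : monom, w = (u' * u'')%M /\ (splits d u' u'' \/ splits d u'' u').

Definition star (k : fieldType) (V : algebra k -> Prop) (d : nat) : Prop :=
  forall u : monom, letters u = iota 0 d.+2 ->
  forall w : monom, w \in [:: u * Var d.+2; Var d.+2 * u]%M ->
  exists2 g : {malg k[monom]},
    lin_comb (star_form d) g & hcongruent V << w >> g.

Definition eight_monomials (x y z : monom) : seq monom :=
  [:: x * (y * z); x * (z * y); (y * z) * x; (z * y) * x;
      y * (x * z); y * (z * x); (x * z) * y; (z * x) * y]%M.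

Definition eight_term_identities (k : fieldType) (V : algebra k -> Prop) :
    Prop :=
  let x := Var 0 in let y := Var 1 in let z := Var 2 in
  forall w : monom, w \in [:: (x * y) * z; z * (x * y)]%M ->
  exists2 g : {malg k[monom]},
    lin_comb (fun v => v \in eight_monomials x y z) g
    & congruent V << w >> g.

Definition jordan_identities (k : fieldType) : seq {malg k[monom]} :=
  let x := Var 0 in let y := Var 1 in
  [:: << (x * y)%M >> - << (y * x)%M >>;
      << ((x * y) * (x * x))%M >> - << (x * (y * (x * x)))%M >>].

Definition jordan (k : fieldType) : algebra k -> Prop :=
  variety_of (fun f => f \in jordan_identities k).

(* Main.v *)
(* (a) A product p * q is [1,1+d]-separating as soon as p or q has length at  *)
(* most d+1. If p is longer, its tree has d+2 subtrees that partition its     *)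
(* string, and (star), with these subtrees for the x_m and q for z, rewrites  *)
(* p * q and q * p into combinations of products one factor of which is       *)
(* shorter than p; conclude by induction on the length of p.                  *)
(* (b) For d = 0 the monomials allowed by (star) are exactly the eight ones,  *)
(* and identities relating them are multilinear, hence homogeneous.           *)
(* (c) Linearizing the Jordan identity and dividing by 2 gives                *)
(* z(y(bc)) = (zy)(bc) + (by)(zc) - b(y(zc)) + (cy)(zb) - c(y(zb)); by        *)
(* commutativity z(y(bc)) is any of the monomials uz and zu with u of         *)
(* degree 3.                                                                  *)

Require Import Defs.
From mathcomp Require Import all_boot all_order all_algebra.
From HB Require Import structures.
From mathcomp Require Import finmap sesquilinear zify.
From mathcomp.multinomials Require Import monalg.

Import GRing.Theory.

Local Open Scope ring_scope.

(** Homogeneous identities survive the substitution of monomials for indeterminates ([hnull_subst]),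
    so a rewriting stated for indeterminates applies to arbitrary products ([reducible_subst]). For
    (a), [subst_truncate] presents a long factor as an instance of a bracketing of d+2 letters, and
    [len_subst_splits] gives the strict decrease for the induction in [star_separative]. For (b) and
    (c), [splitsE] makes the shape of a monomial checkable by computation; (b) becomes a finite
    enumeration, and (c) rests on the linearization [polarize3]. *)

(** * Linear extension of maps defined on monomials *)

Section LinearExtension.

Context {k : fieldType} {K : choiceType} {W : lmodType k}.
Implicit Types (phi : K -> W) (f : {malg k[K]}).

(** Common form of [eval a] and of the substitution [msubst s], so that linearity is proved once. *)
Definition linext phi f : W := \sum_(w <- msupp f) f@_w *: phi w.

Lemma linextEw phi f (D : {fset K}) :
  (msupp f `<=` D)%fset -> linext phi f = \sum_(w <- D) f@_w *: phi w.
Proof.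
move=> fD; rewrite /linext (big_fset_incl _ fD) // => w _ /mcoeff_outdom ->.
by rewrite scale0r.
Qed.

Lemma linext_is_linear phi : linear (linext phi).
Proof.
move=> c f g; pose D := (msupp f `|` msupp g)%fset.
have fD : (msupp f `<=` D)%fset by apply: fsubsetUl.
have gD : (msupp g `<=` D)%fset by apply: fsubsetUr.
have hD : (msupp (c *: f + g) `<=` D)%fset.
  by apply: fsubset_trans (msuppD_le _ _) _; apply/fsetSU/msuppZ_le.
rewrite (linextEw _ _ _ fD) (linextEw _ _ _ gD) (linextEw _ _ _ hD).
rewrite scaler_sumr -big_split; apply: eq_bigr => w _ /=.
by rewrite mcoeffD mcoeffZ scalerDl scalerA.
Qed.

HB.instance Definition _ phi :=
  GRing.isLinear.Build k {malg k[K]} W *:%R (linext phi) (linext_is_linear phi).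

Lemma msupp_basis (w : K) : msupp (<< w >> : {malg k[K]}) = [fset w]%fset.
Proof. by rewrite msuppU oner_eq0. Qed.

Lemma linextU phi (w : K) : linext phi << w >> = phi w.
Proof. by rewrite /linext msupp_basis big_seq_fset1 mcoeffUU scale1r. Qed.

Lemma eq_linext phi1 phi2 : phi1 =1 phi2 -> linext phi1 =1 linext phi2.
Proof. by move=> e f; apply: eq_bigr => w _; rewrite e. Qed.

Lemma malg_lin_combE (f : {malg k[K]}) :
  f = \sum_(w <- msupp f) f@_w *: << w >>.
Proof.
apply/malgP => w; rewrite raddf_sum /= {1}(monalgE f) raddf_sum /=.
by apply: eq_bigr => v _; rewrite mcoeffZ !mcoeffU mulrnAr mulr1.
Qed.

Lemma msupp_sum {I : eqType} (r : seq I) (F : I -> {malg k[K]}) (w : K) :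
  w \in msupp (\sum_(i <- r) F i) -> exists2 i, i \in r & w \in msupp (F i).
Proof.
elim: r => [|i r IH]; first by rewrite big_nil msupp0 inE.
rewrite big_cons => /(fsubsetP (msuppD_le _ _)); rewrite in_fsetU.
case/orP=> [wi|/IH[j jr wj]]; first by exists i; rewrite ?mem_head.
by exists j; rewrite // inE jr orbT.
Qed.

End LinearExtension.

Lemma linext_comp {k : fieldType} {K : choiceType} {W W' : lmodType k}
    (F : {linear W -> W'}) (phi : K -> W) (f : {malg k[K]}) :
  F (linext phi f) = linext (F \o phi) f.
Proof. by rewrite linear_sum; apply: eq_bigr => w _; rewrite linearZ. Qed.

Lemma eval_is_linear {k : fieldType} (A : algebra k) (a : nat -> A) :
  linear (eval a).
Proof. exact: linext_is_linear. Qed.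

HB.instance Definition _ (k : fieldType) (A : algebra k) (a : nat -> A) :=
  GRing.isLinear.Build k {malg k[monom]} A *:%R (eval a)
    (eval_is_linear A a).

Lemma evalU {k : fieldType} (A : algebra k) (a : nat -> A) (w : monom) :
  eval a << w >> = eval_monom a w.
Proof. exact: linextU. Qed.

(** * Substitution of monomials for indeterminates *)

Fixpoint subst (s : nat -> monom) (w : monom) : monom :=
  match w with
  | Var i => s i
  | Mul u v => Mul (subst s u) (subst s v)
  end.

Lemma eq_in_subst (s t : nat -> monom) (w : monom) :
  {in letters w, s =1 t} -> subst s w = subst t w.
Proof.
elim: w => [i|u IHu v IHv] /= st; first by apply: st; rewrite inE.
by rewrite IHu ?IHv // => i iw; apply: st; rewrite mem_cat iw ?orbT.
Qed.

Lemma letters_subst (s : nat -> monom) (w : monom) :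
  letters (subst s w) = flatten [seq letters (s i) | i <- letters w].
Proof.
by elim: w => [i|u IHu v IHv] /=; rewrite ?cats0 // map_cat flatten_cat IHu IHv.
Qed.

Lemma len_subst (s : nat -> monom) (w : monom) :
  len (subst s w) = (\sum_(i <- letters w) len (s i))%N.
Proof.
by rewrite /len letters_subst size_flatten /shape -map_comp sumnE big_map.
Qed.

Lemma count_subst (s : nat -> monom) (w : monom) (i : nat) :
  count_mem i (letters (subst s w)) =
  (\sum_(j <- letters w) count_mem i (letters (s j)))%N.
Proof. by rewrite letters_subst count_flatten -map_comp sumnE big_map. Qed.

Lemma eval_monom_subst {k : fieldType} (A : algebra k) (a : nat -> A)
    (s : nat -> monom) (w : monom) :
  eval_monom a (subst s w) = eval_monom (eval_monom a \o s) w.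
Proof. by elim: w => //= u -> v ->. Qed.

Lemma len_gt0 (w : monom) : (0 < len w)%N.
Proof. by elim: w => //= u IHu v IHv; rewrite /len size_cat addn_gt0 IHu. Qed.

Lemma lenM (u v : monom) : len (Mul u v) = (len u + len v)%N.
Proof. exact: size_cat. Qed.

(* Truncating the tree of p leaves m subtrees hanging, which become the       *)
(* values of the m indeterminates.                                            *)
Lemma subst_truncate (m i0 : nat) (p : monom) : (0 < m <= len p)%N ->
  exists u s, letters u = iota i0 m /\ subst s u = p.
Proof.
elim: p m i0 => [j|p IHp q IHq] m i0.
  by case: m => [|[|m]] // _; exists (Var i0), (fun=> Var j).
rewrite lenM; have [-> _|m1] := eqVneq m 1%N.
  by exists (Var i0), (fun=> Mul p q).
(* The left factor receives as many of the m subtrees as it can while leaving at least one for the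
   right factor. *)
move=> mb; pose m1' := minn (len p) m.-1.
have lp := len_gt0 p; have lq := len_gt0 q.
have [u [s [lu su]]] := IHp m1' i0 ltac:(rewrite /m1'; lia).
have [v [t [lv tv]]] := IHq (m - m1')%N (i0 + m1')%N ltac:(rewrite /m1'; lia).
(* The letters of u and v lie in disjoint intervals, so s and t glue. *)
exists (Mul u v), (fun i => if (i < i0 + m1')%N then s i else t i); split => /=.
  by rewrite lu lv -iotaD; congr iota; rewrite /m1'; lia.
rewrite -su -tv; congr Mul; apply: eq_in_subst => i; rewrite ?lu ?lv mem_iota.
  by case/andP=> _ ->.
by case/andP=> /leq_gtF->.
Qed.

(** * Reduction modulo homogeneous identities *)

Section HomogeneousIdentities.

Context {k : fieldType}.
Variable V : algebra k -> Prop.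
Implicit Types (f g h : {malg k[monom]}) (P : monom -> Prop).

(* [hcongruent V f g] is [hnull (f - g)]. *)
Definition hnull f := exists2 s : seq {malg k[monom]},
  forall h, h \in s -> identity_of V h /\ homogeneous h
  & f = \sum_(h <- s) h.

Lemma hnull1 f : identity_of V f -> homogeneous f -> hnull f.
Proof.
by move=> If Hf; exists [:: f]; rewrite ?big_seq1 // => h /[!inE] /eqP->.
Qed.

Lemma hnull0 : hnull 0.
Proof. by exists [::]; rewrite ?big_nil. Qed.

Lemma hnullD f g : hnull f -> hnull g -> hnull (f + g).
Proof.
move=> [s Hs ->] [t Ht ->]; exists (s ++ t); rewrite ?big_cat // => h.
by rewrite mem_cat => /orP[/Hs|/Ht].
Qed.

Lemma hnullZ c f : hnull f -> hnull (c *: f).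
Proof.
move=> [s Hs ->]; exists [seq c *: h | h <- s]; last first.
  by rewrite big_map scaler_sumr.
move=> _ /mapP[h /Hs[Ih Hh] ->]; split=> [A VA a|].
  by rewrite linearZ /= Ih ?scaler0.
move=> v w /(fsubsetP (msuppZ_le _ _)) vh /(fsubsetP (msuppZ_le _ _)).
exact: Hh.
Qed.

Lemma hnull_identity f : hnull f -> identity_of V f.
Proof.
move=> [s Hs ->] A VA a; rewrite linear_sum big_seq big1 // => h /Hs[Ih _].
exact: Ih.
Qed.

Definition msubst (s : nat -> monom) f : {malg k[monom]} :=
  linext (fun w => << subst s w >>) f.

Lemma msupp_msubst s f (w : monom) :
  w \in msupp (msubst s f) -> exists2 v, v \in msupp f & w = subst s v.
Proof.
case/msupp_sum=> v vf /(fsubsetP (msuppZ_le _ _)).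
by rewrite msupp_basis inE => /eqP; exists v.
Qed.

(** Evaluating a substituted identity at [a] is evaluating the identity at [eval_monom a \o s];
    letter counts after substitution depend only on letter counts before. *)
Lemma hnull_subst s f : hnull f -> hnull (msubst s f).
Proof.
move=> [hs Hs ->]; exists [seq msubst s h | h <- hs].
  move=> _ /mapP[h /Hs[Ih Hh] ->]; split=> [A VA a|].
    rewrite linext_comp -(Ih A VA (eval_monom a \o s)).
    by apply: eq_linext => w /=; rewrite evalU eval_monom_subst.
  move=> v w /msupp_msubst[v' v'h ->] /msupp_msubst[w' w'h ->] i.
  rewrite !count_subst; apply: perm_big; apply/allP => j _; apply/eqP.
  exact: Hh.
by rewrite big_map /msubst linear_sum.
Qed.

(** Both [star] and [separative] assert this of certain monomials, for different [P]. *)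
Definition reducible P f := exists2 g, lin_comb P g & hcongruent V f g.

Lemma reducible_mem P w : P w -> reducible P << w >>.
Proof.
move=> Pw; exists << w >>; last by rewrite /hcongruent subrr; apply: hnull0.
by move=> v; rewrite msupp_basis inE => /eqP->.
Qed.

Lemma reducible_sum P (r : seq monom) (c : monom -> k) :
    (forall w, w \in r -> reducible P << w >>) ->
  reducible P (\sum_(w <- r) c w *: << w >>).
Proof.
elim: r => [|v r IH] Hr.
  rewrite big_nil; exists 0; first by move=> w; rewrite msupp0 inE.
  by rewrite /hcongruent subrr; apply: hnull0.
have [w wr|g Pg fg] := IH; first by apply: Hr; rewrite inE wr orbT.
have [h Ph vh] := Hr v (mem_head _ _).
exists (c v *: h + g).
  move=> w /(fsubsetP (msuppD_le _ _)); rewrite in_fsetU => /orP[|/Pg //].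
  by move/(fsubsetP (msuppZ_le _ _))/Ph.
rewrite big_cons /hcongruent opprD addrACA -scalerBr.
by apply: hnullD => //; apply: hnullZ.
Qed.

Lemma reducible_trans P f g : hcongruent V f g ->
  (forall w, w \in msupp g -> reducible P << w >>) -> reducible P f.
Proof.
move=> fg /(reducible_sum P _ (mcoeff^~ g)); rewrite -malg_lin_combE.
case=> h Ph gh; exists h => //; rewrite /hcongruent -(subrKA g).
exact: hnullD.
Qed.

(** The substituted [P]-monomials need only be reducible to [Q] themselves, which leaves room for an
    induction hypothesis. *)
Lemma reducible_subst P Q s w : reducible P << w >> ->
    (forall v, P v -> reducible Q << subst s v >>) ->
  reducible Q << subst s w >>.
Proof.
case=> g Pg wg PQ; apply: (reducible_trans _ _ (msubst s g)).
  by move/(hnull_subst s): wg; rewrite /msubst linearB /= linextU.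
by move=> _ /msupp_msubst[v /Pg/PQ ? ->].
Qed.

End HomogeneousIdentities.

(** * Splittings of the indeterminates, and part (a) *)

(** The set [B] is recovered as the letters of p; it is proper exactly when q has a letter besides
    z. The right-hand side computes on concrete monomials. *)
Lemma splitsE d p q : splits d p q <->
  [/\ perm_eq (letters p ++ letters q) (iota 0 d.+3),
      d.+2 \in letters q & (1 < len q)%N].
Proof.
split=> [[B [B0 BT pB qB]]|[pq zq q1]].
  split; last 2 first.
  - by rewrite (perm_mem qB) mem_head.
  - rewrite /len (perm_size qB) /= size_map -cardE ltnS card_gt0.
    by apply: contraTneq BT => C0; rewrite -[B]setCK C0 setC0 properxx.
  apply: perm_trans (perm_cat pB qB) _.
  rewrite perm_catC cat_cons -map_cat -(addn1 d.+2) iotaD cats1 perm_sym.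
  rewrite perm_rcons perm_cons perm_sym -val_enum_ord perm_map //.
  apply: uniq_perm.
  - rewrite cat_uniq !enum_uniq andbT /=; apply/hasPn => i.
    by rewrite !mem_enum in_setC negbK.
  - exact: enum_uniq.
  by move=> i; rewrite mem_cat !mem_enum in_setC orNb.
have Upq : uniq (letters p ++ letters q) by rewrite (perm_uniq pq) iota_uniq.
have [Up Dpq Uq] : [/\ uniq (letters p),
    forall i, i \in letters q -> i \notin letters p & uniq (letters q)].
  by move: Upq; rewrite cat_uniq => /and3P[? /hasPn].
have Mpq i : (i \in letters p) || (i \in letters q) = (i < d.+3)%N.
  by rewrite -mem_cat (perm_mem pq) mem_iota.
have plt i : i \in letters p -> (i < d.+2)%N.
  move=> ip; have := Mpq i; rewrite ip ltnS leq_eqVlt => /esym/orP[/eqP e|//].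
  by move: (Dpq _ zq); rewrite -e ip.
pose B := [set i : 'I_d.+2 | val i \in letters p].
exists B; split.
- have /hasP[i ip _] : has predT (letters p) by rewrite has_predT len_gt0.
  by apply/set0Pn; exists (Ordinal (plt i ip)); rewrite inE.
- rewrite properE subsetT /=; apply/subsetPn.
  have [i iq iz] : exists2 i, i \in letters q & i != d.+2.
    rewrite /len in q1.
    case: (letters q) q1 zq Uq {Dpq Mpq Upq pq} => [//|i [//|j s]] _ _ /=.
    move=> /andP[].
    rewrite inE negb_or => /andP[ij _] _.
    have [iz|] := eqVneq i d.+2; last by exists i; rewrite ?mem_head.
    by exists j; rewrite ?inE ?eqxx ?orbT // -iz eq_sym.
  have ilt : (i < d.+2)%N.
    by have := Mpq i; rewrite iq orbT ltnS leq_eqVlt (negPf iz) => /esym.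
  by exists (Ordinal ilt); rewrite ?inE //= Dpq.
- apply: uniq_perm => //; first by rewrite (map_inj_uniq val_inj) enum_uniq.
  move=> i; apply/idP/mapP => [ip|[j]]; last by rewrite mem_enum inE => ? ->.
  by exists (Ordinal (plt i ip)); rewrite // mem_enum inE.
- apply: uniq_perm => //=.
    rewrite (map_inj_uniq val_inj) enum_uniq andbT; apply/mapP => -[j _ /= e].
    by have := ltn_ord j; rewrite -e ltnn.
  move=> i; rewrite inE; apply/idP/idP.
    move=> iq; have [//|iz] := eqVneq i d.+2; apply/mapP.
    have ilt : (i < d.+2)%N.
      by have := Mpq i; rewrite iq orbT ltnS leq_eqVlt (negPf iz) => /esym.
    by exists (Ordinal ilt); rewrite // mem_enum !inE /= Dpq.
  case/orP=> [/eqP-> //|/mapP[j]]; rewrite mem_enum !inE => jp ->.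
  by have := Mpq j; rewrite (negPf jp) (leq_trans (ltn_ord j)).
Qed.

(** Some x_j is missing from p, and its value has positive length. *)
Lemma len_subst_splits d p q s : splits d p q ->
  (len (subst s p) < \sum_(i <- iota 0 d.+2) len (s i))%N.
Proof.
case=> B [_ /properP[_ [j _ jB]] pB _].
rewrite len_subst (perm_big _ pB) -val_enum_ord !big_map !big_enum /=.
rewrite [ltnRHS](bigID (mem B)) /= -[ltnLHS]addn0 ltn_add2l.
by rewrite (bigD1 j) //= ltn_addr // len_gt0.
Qed.

Lemma range_separatingM d p q : (len p <= 1 + d)%N ->
  range_separating 1 (1 + d) (Mul p q) /\ range_separating 1 (1 + d) (Mul q p).
Proof.
have self w : w \in submonomials w by case: w => *; rewrite mem_head.
move=> pd; split; exists (len p); rewrite ?len_gt0 //; exists q.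
- by rewrite /= inE mem_cat self !orbT.
- by rewrite lenM addnC.
- by rewrite /= inE mem_cat self !orbT.
- by rewrite lenM.
Qed.

Lemma star_separative (k : fieldType) (V : algebra k -> Prop) (d : nat) :
  star V d -> separative V d.
Proof.
move=> starV; pose R w := reducible V (range_separating 1 (1 + d)) << w >>.
(* Both orders are proved together, since [star_form] allows the z-free factor on either side; q is
   arbitrary because the other factor may grow. *)
suff main n p q : (len p <= n)%N -> R (Mul p q) /\ R (Mul q p).
  by case=> [//|p q] _; exact: (main (len p) p q (leqnn _)).1.
elim: n p q => [|n IH] p q; first by rewrite leqn0 -[_ == _]negbK -lt0n len_gt0.
move=> pn; have [pd|dp] := leqP (len p) (1 + d).
  by have [pq qp] := range_separatingM d p q pd; split; apply: reducible_mem.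
have [u [s [lu su]]] := subst_truncate d.+2 0 p dp.
(* [t] sends z to q and the x_m to the subtrees of p. *)
pose t i := if i == d.+2 then q else s i.
have tu : subst t u = p.
  rewrite -su; apply: eq_in_subst => i; rewrite lu mem_iota /t.
  by case: eqP => // ->; rewrite ltnn.
have ltp : len p = (\sum_(i <- iota 0 d.+2) len (t i))%N.
  by rewrite -tu len_subst lu.
have Rt v : star_form d v -> R (subst t v).
  case=> [u' [u'' [-> /= [] /(len_subst_splits _ _ _ t)]]]; rewrite -ltp => lt.
    exact: (IH _ _ (leq_trans lt pn)).1.
  exact: (IH _ _ (leq_trans lt pn)).2.
split.
  have := reducible_subst V _ _ t _ (starV u lu (Mul u (Var d.+2)) _) Rt.
  by rewrite /= tu /t eqxx; apply; rewrite mem_head.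
have := reducible_subst V _ _ t _ (starV u lu (Mul (Var d.+2) u) _) Rt.
by rewrite /= tu /t eqxx; apply; rewrite !inE eqxx orbT.
Qed.

(** * The case d = 0, part (b) *)

Lemma letters_len1 w : len w = 1%N -> exists i, w = Var i.
Proof.
case: w => [i _|u v]; first by exists i.
by rewrite lenM; have := len_gt0 u; have := len_gt0 v; lia.
Qed.

Lemma letters_len2 w : len w = 2%N -> exists i j, w = Mul (Var i) (Var j).
Proof.
case: w => [//|u v]; rewrite lenM => uv.
have := len_gt0 u; have := len_gt0 v => v0 u0.
have [i ->] := letters_len1 u ltac:(lia).
by have [j ->] := letters_len1 v ltac:(lia); exists i, j.
Qed.

(** The z-free factor must be a single letter and the other a product of two, leaving finitely many
    cases. *)
Lemma star_form0E w :
  star_form 0 w <-> w \in eight_monomials (Var 0) (Var 1) (Var 2).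
Proof.
split; last first.
  rewrite !inE; do 7?[case/orP]; move/eqP=> ->; do 2!eexists; split=> //;
    by [left; apply/splitsE | right; apply/splitsE].
have eight p q : splits 0 p q ->
    Mul p q \in eight_monomials (Var 0) (Var 1) (Var 2) /\
    Mul q p \in eight_monomials (Var 0) (Var 1) (Var 2).
  case/splitsE=> pq zq q1; have := perm_size pq; rewrite size_cat /= => s3.
  have p0 := len_gt0 p; rewrite /len in p0 q1.
  have [i ei] := letters_len1 p ltac:(rewrite /len; lia).
  have [j [l ej]] := letters_len2 q ltac:(rewrite /len; lia).
  have lt3 m : m \in letters p ++ letters q -> (m < 3)%N.
    by rewrite (perm_mem pq) mem_iota.
  subst p q; move: (lt3 i) (lt3 j) (lt3 l) pq zq; rewrite !inE !eqxx !orbT.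
  move=> /(_ isT) + /(_ isT) + /(_ isT).
  by case: i {s3 p0 q1 lt3} => [|[|[|//]]] _; case: j => [|[|[|//]]] _;
     case: l => [|[|[|//]]].
by case=> [u' [u'' [-> [] /eight[]]]].
Qed.

Lemma eight_monomials_letters w :
  w \in eight_monomials (Var 0) (Var 1) (Var 2) ->
  perm_eq (letters w) (iota 0 3).
Proof. by rewrite !inE; do 7?[case/orP]; move/eqP=> ->. Qed.

Lemma homogeneousB_lin_comb (k : fieldType) (r : seq nat) (w : monom)
    (g : {malg k[monom]}) :
    perm_eq (letters w) r -> lin_comb (fun v => perm_eq (letters v) r) g ->
  homogeneous (<< w >> - g).
Proof.
move=> wr gr.
have fr v : v \in msupp (<< w >> - g) -> perm_eq (letters v) r.
  move/(fsubsetP (msuppB_le _ _)); rewrite in_fsetU => /orP[|/gr//].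
  by rewrite msupp_basis inE => /eqP->.
by move=> u v /fr/permP eu /fr/permP ev i; rewrite eu ev.
Qed.

(** The two congruences differ only by homogeneity, which is automatic here: all monomials involved
    use each of the three letters once. *)
Lemma star0E (k : fieldType) (V : algebra k -> Prop) :
  star V 0 <-> eight_term_identities V.
Proof.
split=> [starV x y z w ww|eightV u lu w].
  have [g g8 wg] := starV (Mul (Var 0) (Var 1)) erefl w ww.
  exists g; last exact: hnull_identity.
  by move=> v /g8/star_form0E.
have -> : u = Mul (Var 0) (Var 1).
  have [i [j e]] := letters_len2 u (congr1 size lu).
  by move: lu; rewrite e => -[-> ->].
move=> ww; have [g g8 wg] := eightV w ww; exists g.
  by move=> v /g8/star_form0E.
apply: (hnull1 _ _ wg); apply: (homogeneousB_lin_comb k (iota 0 3)).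
  by move: ww; rewrite !inE => /orP[]/eqP->.
by move=> v /g8/eight_monomials_letters.
Qed.

(** * Linearized Jordan identity, part (c) *)

Lemma polarize3 {U W : zmodType} (T : U -> U -> U -> W) :
    (forall y z, {morph (fun x => T x y z) : x x' / x + x'}) ->
    (forall x z, {morph (fun y => T x y z) : y y' / y + y'}) ->
    (forall x y z, T x y z = T x z y) ->
    (forall x, T x x x = 0) ->
  forall a b c, (T a b c + T b a c + T c a b) *+ 2 = 0.
Proof.
move=> D1 D2 C T0 a b c.
have D3 x y : {morph (fun z => T x y z) : z z' / z + z'}.
  by move=> z z'; rewrite !(C x y) D2.
(* The part of T (x+y) (x+y) (x+y) of degree 2 in x and 1 in y. Only the sum [S x y + S y x] is
   shown to vanish, which needs no scalars. *)
pose S x y := T x x y + T x y x + T y x x.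
have S0 x y : S x y + S y x = 0.
  rewrite -(T0 (x + y)) !(D1, D2, D3) /S !addrA !T0 add0r addr0.
  by rewrite [RHS](ACl (1*2*4*6*5*3)).
have SDl : S (a + c) b = S a b + S c b +
    (T a b c + T a c b + T b a c + T b c a + T c a b + T c b a).
  rewrite /S !(D1, D2, D3) !addrA.
  by rewrite [LHS](ACl (1*5*9*4*8*12*6*2*10*11*3*7)).
have SDr : S b (a + c) = S b a + S b c.
  by rewrite /S !(D1, D2, D3) !addrA [LHS](ACl (1*3*5*2*4*6)).
have -> : (T a b c + T b a c + T c a b) *+ 2 =
    T a b c + T a c b + T b a c + T b c a + T c a b + T c b a.
  by rewrite (C a c) (C b c) (C c b) !mulrnDl !mulr2n !addrA.
(* Expanding [S (a + c) b + S b (a + c) = 0] and cancelling the pairs (a,b) and (c,b) leaves the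
   six-term sum. *)
by rewrite -[RHS](S0 (a + c) b) SDl SDr [RHS]addrAC
  [X in _ = X + _]addrACA !S0 !add0r.
Qed.

Lemma jordanP (k : fieldType) (A : algebra k) : jordan A ->
  (forall x y, amul A x y = amul A y x) /\
  (forall x y, amul A (amul A x y) (amul A x x) =
               amul A x (amul A y (amul A x x))).
Proof.
move=> JA; pose a x y (i : nat) : A := if i == 0 then x else y.
split=> x y; apply: subr0_eq.
  have := JA _ (mem_head _ _) (a x y).
  by rewrite linearB /= !evalU.
have := JA _ (mem_last _ _) (a x y).
by rewrite linearB /= !evalU.
Qed.

Lemma jordan_linearized (k : fieldType) (A : algebra k) :
    2%N \notin [pchar k] -> jordan A -> forall y b c z : A,
  amul A z (amul A y (amul A b c)) =
    amul A (amul A z y) (amul A b c) + amul A (amul A b y) (amul A z c)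
    - amul A b (amul A y (amul A z c)) + amul A (amul A c y) (amul A z b)
    - amul A c (amul A y (amul A z b)).
Proof.
move=> k2 /jordanP[C J] y b c z.
(* The defect of the Jordan identity, with the square xx replaced by x'x''. *)
pose T x x' x'' := amul A (amul A x y) (amul A x' x'')
                   - amul A x (amul A y (amul A x' x'')).
have TC x x' x'' : T x x' x'' = T x x'' x' by rewrite /T (C x' x'').
have D1 x' x'' : {morph (fun x => T x x' x'') : u v / u + v}.
  by move=> u v; rewrite /T !linearDl opprD addrACA.
have D2 x x'' : {morph (fun x' => T x x' x'') : u v / u + v}.
  by move=> u v; rewrite /T linearDl !linearDr opprD addrACA.
have T0 x : T x x x = 0 by rewrite /T J subrr.
have := polarize3 T D1 D2 TC T0 z b c.
move/eqP; rewrite -scaler_nat scaler_eq0; case/orP=> [k0|/eqP].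
  by move: k2; rewrite !inE /= k0.
rewrite /T => E; apply/esym/subr0_eq; rewrite -E !addrA.
by rewrite [LHS](ACl (1*6*2*3*4*5)).
Qed.

(** The right-hand side of [jordan_linearized], term by term, as coefficients and monomials. *)
Definition jordan_expansion (k : fieldType) (y b c z : monom) :
    seq (k * monom) :=
  [:: (1, z * y * (b * c)); (1, b * y * (z * c)); (-1, b * (y * (z * c)));
      (1, c * y * (z * b)); (-1, c * (y * (z * b)))]%M.

Lemma reducible_jordan (k : fieldType) (P : monom -> Prop) (r : seq nat)
    (y b c z w : monom) :
    2%N \notin [pchar k] ->
    (forall A : algebra k, jordan A -> forall a : nat -> A,
       eval_monom a w = eval_monom a (Mul z (Mul y (Mul b c)))) ->
    perm_eq (letters w) r ->
    (forall v, v \in unzip2 (jordan_expansion k y b c z) ->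
       P v /\ perm_eq (letters v) r) ->
  reducible (@jordan k) P << w >>.
Proof.
move=> k2 Ew wr Pr; pose s := jordan_expansion k y b c z.
pose g : {malg k[monom]} := \sum_(p <- s) p.1 *: << p.2 >>.
have gs v : v \in msupp g -> v \in unzip2 s.
  case/msupp_sum=> p ps /(fsubsetP (msuppZ_le _ _)).
  by rewrite msupp_basis inE => /eqP->; apply: map_f.
exists g; first by move=> v /gs/Pr[].
apply: hnull1; last first.
  by apply: homogeneousB_lin_comb wr _ => v /gs/Pr[].
move=> A JA a.
have Eg : eval a g = \sum_(p <- s) p.1 *: eval_monom a p.2.
  by rewrite linear_sum; apply: eq_bigr => p _; rewrite linearZ /= evalU.
rewrite linearB /= evalU Ew // Eg !big_cons big_nil /=.
rewrite !scale1r !scaleN1r addr0 !addrA.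
by rewrite (jordan_linearized k A k2 JA) subrr.
Qed.

Lemma jordan_star1 (k : fieldType) :
  2%N \notin [pchar k] -> star (@jordan k) 1.
Proof.
move=> k2 u lu w wu.
have uE : u \in [:: Var 0 * Var 1 * Var 2; Var 0 * (Var 1 * Var 2)]%M.
  case: u lu {wu} => [//|p q] /= lu.
  have pq : (len p + len q = 3)%N by rewrite -lenM /len /= lu.
  have [p1|p2] : len p = 1%N \/ len p = 2%N.
  - by have := len_gt0 p; have := len_gt0 q; lia.
  - have [i ei] := letters_len1 p p1.
    have [j [l ej]] := letters_len2 q ltac:(lia).
    by move: lu; rewrite ei ej => -[-> -> ->].
  have [i [j ei]] := letters_len2 p p2.
  have [l ej] := letters_len1 q ltac:(lia).
  by move: lu; rewrite ei ej => -[-> -> ->].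
pose J y b c := unzip2 (jordan_expansion k (Var y) (Var b) (Var c) (Var 3)).
(* In each of the five terms one outer factor avoids z: bc, by, b, cy or c. *)
have formI v : v \in J 2 0 1 ++ J 0 1 2 ->
    star_form 1 v /\ perm_eq (letters v) (iota 0 4).
  rewrite !inE; do 9?[case/orP]; move/eqP=> ->; split=> //;
    do 2!eexists; split=> //;
    by [left; apply/splitsE | right; apply/splitsE].
have expand y b c : w \in [:: y * (b * c) * Var 3; b * c * y * Var 3;
      Var 3 * (y * (b * c)); Var 3 * (b * c * y)]%M ->
    forall A : algebra k, jordan A -> forall a : nat -> A,
    eval_monom a w = eval_monom a (Mul (Var 3) (Mul y (Mul b c))).
  move=> wE A /jordanP[C _] a; move: wE; rewrite !inE => /or4P[] /eqP-> //=.
    by rewrite C (C (amul A _ _) (eval_monom a y)).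
  by rewrite (C (amul A _ _) (eval_monom a y)).
(* For u = (x_1 x_2)x_3 the role of y is played by x_3, for u = x_1(x_2 x_3) by x_1. *)
move: uE wu; rewrite !inE => /orP[]/eqP-> wE.
  apply: (reducible_jordan k _ (iota 0 4) (Var 2) (Var 0) (Var 1) (Var 3) w k2).
  - by apply: expand; case/orP: wE => /eqP->; rewrite !inE eqxx ?orbT.
  - by case/orP: wE => /eqP->.
  by move=> v vE; apply: formI; rewrite mem_cat vE.
apply: (reducible_jordan k _ (iota 0 4) (Var 0) (Var 1) (Var 2) (Var 3) w k2).
- by apply: expand; case/orP: wE => /eqP->; rewrite !inE eqxx ?orbT.
- by case/orP: wE => /eqP->.
by move=> v vE; apply: formI; rewrite mem_cat vE orbT.
Qed.

Theorem proposition14 (k : fieldType) :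
  [/\ (* (a) *)
      forall V : algebra k -> Prop, is_variety V ->
        forall d : nat, star V d -> separative V d,
      (* (b) *)
      forall V : algebra k -> Prop, is_variety V ->
        (star V 0 <-> eight_term_identities V)
    & (* (c) *)
      2%N \notin [pchar k] -> star (@jordan k) 1].
Proof.
split=> [V _ d|V _|].
- exact: star_separative.
- exact: star0E.
exact: jordan_star1.
Qed.
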